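(* Let $V$, $W$, $Z$ be generalized complex vector spaces, and let $\Gamma\subset V\oplus W$, $\Phi\subset W\oplus Z$ be relations (linear subspaces), with composition $\Phi\circ\Gamma\subset V\oplus Z$. (a) If $\Gamma$, $\Phi$ are generalized isotropic subspaces with respect to the twisted product structures on $V\oplus W$ and $W\oplus Z$, then $\Phi\circ\Gamma$ is a generalized isotropic subspace with respect to the twisted product structure on $V\oplus Z$. (b) If $\Gamma$, $\Phi$ are generalized coisotropic subspaces with respect to the twisted product structures on $V\oplus W$ and $W\oplus Z$, then $\Phi\circ\Gamma$ is a generalized coisotropic subspace with respect to the twisted product structure on $V\oplus Z$. (c) If $\Gamma$, $\Phi$ are generalized Lagrangian subspaces with respect to the twisted product structures on $V\oplus W$ and $W\oplus Z$, then $\Phi\circ\Gamma$ is a generalized Lagrangian subspace with respect to the twisted product structure on $V\oplus Z$.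
   Context: All vector spaces are finite-dimensional; $\operatorname{Ann}$ denotes the annihilator. On $V\oplus V^*$ use the pairing $\langle v+f,w+g\rangle=-\tfrac12(f(w)+g(v))$. A generalized complex (GC) structure on a real vector space $V$ is an $\mathbb R$-linear automorphism $\mathcal J$ of $V\oplus V^*$ that is orthogonal for $\langle\cdot,\cdot\rangle$ and satisfies $\mathcal J^2=-1$. Write $\mathcal J=\begin{pmatrix}\mathcal J_1&\mathcal J_2\\ \mathcal J_3&\mathcal J_4\end{pmatrix}$ with $\mathcal J_1:V\to V$, $\mathcal J_2:V^*\to V$, $\mathcal J_3:V\to V^*$, $\mathcal J_4:V^*\to V^*$. A GC vector space is a real vector space with a GC structure. The direct sum of GC structures $\mathcal J_U$ on $U$ and $\mathcal J_V$ on $V$ is given by $\mathcal J_U\oplus\mathcal J_V$ under the natural identification $(U\oplus V)\oplus(U\oplus V)^*\cong U\oplus U^*\oplus V\oplus V^*$. The twist of $\mathcal J$ is $\tilde{\mathcal J}=\begin{pmatrix}\mathcal J_1&-\mathcal J_2\\ -\mathcal J_3&\mathcal J_4\end{pmatrix}$. The twisted product structure on $V\oplus W$ is the direct sum of $\tilde{\mathcal J}_V$ and $\mathcal J_W$ (first factor twisted). A subspace $U$ of a GC vector space $(X,\mathcal J)$ is generalized isotropic if $\mathcal J(U)\subseteq U\oplus\operatorname{Ann}(U)$, generalized coisotropic if $\mathcal J(\operatorname{Ann}(U))\subseteq U\oplus\operatorname{Ann}(U)$, and generalized Lagrangian if it is both. A relation from $V$ to $W$ is a linear subspace of $V\oplus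 W$. The composition of $\Gamma\subset V\oplus W$ and $\Phi\subset W\oplus Z$ is $\Phi\circ\Gamma=\{(v,z)\in V\oplus Z:\text{there exists }w\in W\text{ with }(v,w)\in\Gamma\text{ and }(w,z)\in\Phi\}$. *)

(* Defs.v *)
From HB Require Import structures.
From mathcomp Require Import all_boot all_algebra.
From mathcomp Require Import reals.

Set Implicit Arguments.
Unset Strict Implicit.
Unset Printing Implicit Defensive.

Import GRing.Theory.
Local Open Scope ring_scope.

(* Products, duals and V (+) V^* are bundled as vectTypes: instance inference
   on iterated unbundled types such as V * 'Hom(V, R^o) is prohibitively slow. *)
Section Carriers.
Variable R : realType.
Implicit Types A B V : vectType R.

Definition vprod A B : vectType R := (A * B)%type.
Definition vdual V : vectType R := 'Hom(V, R^o).
Definition gtan V : vectType R := vprod V (vdual V).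

Definition vfst A B (x : vprod A B) : A := x.1.
Definition vsnd A B (x : vprod A B) : B := x.2.
Definition vpair A B (a : A) (b : B) : vprod A B := (a, b).
Definition vinl A B (a : A) : vprod A B := vpair a 0.
Definition vinr A B (b : B) : vprod A B := vpair 0 b.

(* Evaluation of a linear form. *)
Definition vev V (f : vdual V) (v : V) : R := (f : 'Hom(V, R^o)) v.

Definition precomp A B (h : 'Hom(A, B)) (f : vdual B) : vdual A :=
  ((f : 'Hom(B, R^o)) \o h)%VF.

Fact vfst_linear A B : linear (@vfst A B). Proof. by []. Qed.
Fact vsnd_linear A B : linear (@vsnd A B). Proof. by []. Qed.
Fact vinl_linear A B : linear (@vinl A B).
Proof. by move=> k x y; congr pair; rewrite /= scaler0 addr0. Qed.
Fact vinr_linear A B : linear (@vinr A B).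
Proof. by move=> k x y; congr pair; rewrite /= scaler0 addr0. Qed.
Fact precomp_linear A B (h : 'Hom(A, B)) : linear (precomp h).
Proof. by move=> k f g; rewrite /precomp comp_lfunDl -comp_lfunZl. Qed.

HB.instance Definition _ A B :=
  GRing.isLinear.Build R (vprod A B) A _ (@vfst A B) (@vfst_linear A B).
HB.instance Definition _ A B :=
  GRing.isLinear.Build R (vprod A B) B _ (@vsnd A B) (@vsnd_linear A B).
HB.instance Definition _ A B :=
  GRing.isLinear.Build R A (vprod A B) _ (@vinl A B) (@vinl_linear A B).
HB.instance Definition _ A B :=
  GRing.isLinear.Build R B (vprod A B) _ (@vinr A B) (@vinr_linear A B).
HB.instance Definition _ A B (h : 'Hom(A, B)) :=
  GRing.isLinear.Build R (vdual B) (vdual A) _ (precomp h) (precomp_linear h).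

End Carriers.

Section LinearMaps.
Variable R : realType.
Implicit Types A B C D V X : vectType R.

Definition fstl A B : 'Hom(vprod A B, A) := linfun (@vfst R A B).
Definition sndl A B : 'Hom(vprod A B, B) := linfun (@vsnd R A B).
Definition inll A B : 'Hom(A, vprod A B) := linfun (@vinl R A B).
Definition inrl A B : 'Hom(B, vprod A B) := linfun (@vinr R A B).
Definition pullback A B (h : 'Hom(A, B)) : 'Hom(vdual B, vdual A) :=
  linfun (precomp h).

Definition pairl X A B (f : 'Hom(X, A)) (g : 'Hom(X, B)) : 'Hom(X, vprod A B) :=
  ((inll A B \o f) + (inrl A B \o g))%VF.

(* The map A (+) B -> C (+) D with rows (f g) and (h k). *)
Definition blockl A B C D (f : 'Hom(A, C)) (g : 'Hom(B, C))
    (h : 'Hom(A, D)) (k : 'Hom(B, D)) : 'Hom(vprod A B, vprod C D) :=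
  pairl ((f \o fstl A B) + (g \o sndl A B))%VF
        ((h \o fstl A B) + (k \o sndl A B))%VF.

Lemma vpair_eta A B (x : vprod A B) : x = vpair (vfst x) (vsnd x).
Proof. by case: x. Qed.

Lemma vpairD A B (a a' : A) (b b' : B) :
  vpair a b + vpair a' b' = vpair (a + a') (b + b').
Proof. by []. Qed.

Lemma vpairN A B (a : A) (b : B) : - vpair a b = vpair (- a) (- b).
Proof. by []. Qed.

Lemma fstlE A B x : fstl A B x = vfst x. Proof. by rewrite lfunE. Qed.
Lemma sndlE A B x : sndl A B x = vsnd x. Proof. by rewrite lfunE. Qed.
Lemma inllE A B a : inll A B a = vpair a 0. Proof. by rewrite lfunE. Qed.
Lemma inrlE A B b : inrl A B b = vpair 0 b. Proof. by rewrite lfunE. Qed.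

Lemma pairlE X A B (f : 'Hom(X, A)) (g : 'Hom(X, B)) x :
  pairl f g x = vpair (f x) (g x).
Proof. by rewrite add_lfunE !comp_lfunE inllE inrlE vpairD addr0 add0r. Qed.

Lemma blocklE A B C D (f : 'Hom(A, C)) (g : 'Hom(B, C))
    (h : 'Hom(A, D)) (k : 'Hom(B, D)) x :
  blockl f g h k x =
  vpair (f (vfst x) + g (vsnd x)) (h (vfst x) + k (vsnd x)).
Proof. by rewrite pairlE !add_lfunE !comp_lfunE fstlE sndlE. Qed.

Lemma vdualP V (f g : vdual V) : (forall v, vev f v = vev g v) -> f = g.
Proof. by move=> fg; apply/lfunP. Qed.

Lemma vev_pullback A B (h : 'Hom(A, B)) (f : vdual B) a :
  vev (pullback h f) a = vev f (h a).
Proof. by rewrite /vev lfunE /= comp_lfunE. Qed.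

Lemma vev0l V (v : V) : vev 0 v = 0. Proof. exact: (@zero_lfunE R V R^o v). Qed.
Lemma vevDl V (f g : vdual V) v : vev (f + g) v = vev f v + vev g v.
Proof. exact: (@add_lfunE R V R^o f g v). Qed.
Lemma vevNl V (f : vdual V) v : vev (- f) v = - vev f v.
Proof. exact: (@opp_lfunE R V R^o f v). Qed.
Lemma vev0r V (f : vdual V) : vev f 0 = 0. Proof. exact: (linear0 (f : 'Hom(V, R^o))). Qed.
Lemma vevDr V (f : vdual V) u v : vev f (u + v) = vev f u + vev f v.
Proof. exact: (linearD (f : 'Hom(V, R^o))). Qed.
Lemma vevNr V (f : vdual V) v : vev f (- v) = - vev f v.
Proof. exact: (linearN (f : 'Hom(V, R^o))). Qed.

Definition dsumv A B (U : {vspace A}) (U' : {vspace B}) : {vspace vprod A B} :=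
  (inll A B @: U + inrl A B @: U')%VS.

Lemma memv_dsumv A B (U : {vspace A}) (U' : {vspace B}) a b :
  (vpair a b \in dsumv U U') = (a \in U) && (b \in U').
Proof.
apply/memv_addP/andP => [[_ /memv_imgP[a' Ua ->] [_ /memv_imgP[b' Ub ->]]]|[Ua Ub]].
  by rewrite inllE inrlE vpairD addr0 add0r => -[-> ->].
exists (inll A B a); first exact: memv_img.
exists (inrl A B b); first exact: memv_img.
by rewrite inllE inrlE vpairD addr0 add0r.
Qed.

(* The kernel of the restriction map V^* -> U^*. *)
Definition annv V (U : {vspace V}) : {vspace vdual V} :=
  lker (pullback (linfun (@vsval _ _ U))).

Lemma memv_annv V (U : {vspace V}) (f : vdual V) :
  reflect (forall u, u \in U -> vev f u = 0) (f \in annv U).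
Proof.
rewrite memv_ker; apply: (iffP eqP) => [f0 u Uu|f0].
  by rewrite -(vev0l (Subvs Uu)) -f0 vev_pullback lfunE.
by apply/vdualP => u; rewrite vev_pullback lfunE vev0l; apply/f0/subvsP.
Qed.

End LinearMaps.

Section GeneralizedComplex.
Variable R : realType.
Implicit Types V W : vectType R.

Definition gpairing V (x y : gtan V) : R :=
  - (2%:R^-1 * (vev (vsnd x) (vfst y) + vev (vsnd y) (vfst x))).

(* Bijectivity of J is automatic from J^2 = -1. *)
Record gcStruct V := GCStruct {
  gcJ :> 'End(gtan V);
  gcJ_orth : forall x y, gpairing (gcJ x) (gcJ y) = gpairing x y;
  gcJ_sqr : (gcJ \o gcJ)%VF = - \1%VF }.

Lemma gcJK V (J : gcStruct V) x : J (J x) = - x.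
Proof. by rewrite -comp_lfunE gcJ_sqr opp_lfunE id_lfunE. Qed.

Section Blocks.
Variables (V : vectType R) (J : 'End(gtan V)).

Definition gcJ1 : 'Hom(V, V) := (fstl _ _ \o J \o inll _ _)%VF.
Definition gcJ2 : 'Hom(vdual V, V) := (fstl _ _ \o J \o inrl _ _)%VF.
Definition gcJ3 : 'Hom(V, vdual V) := (sndl _ _ \o J \o inll _ _)%VF.
Definition gcJ4 : 'Hom(vdual V, vdual V) := (sndl _ _ \o J \o inrl _ _)%VF.

Lemma gcJ_blockE : J = blockl gcJ1 gcJ2 gcJ3 gcJ4.
Proof.
apply/lfunP => x; rewrite blocklE !comp_lfunE -!linearD inllE inrlE.
by rewrite vpairD addr0 add0r -vpair_eta /= fstlE sndlE -vpair_eta.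
Qed.

Definition twist_lfun : 'End(gtan V) := blockl gcJ1 (- gcJ2) (- gcJ3) gcJ4.

(* The twist is the conjugate of J by (v, f) |-> (v, - f). *)
Lemma twist_lfunE v f :
  twist_lfun (vpair v f) =
  vpair (vfst (J (vpair v (- f)))) (- vsnd (J (vpair v (- f)))).
Proof.
have -> : J (vpair v (- f)) = vpair (gcJ1 v - gcJ2 f) (gcJ3 v - gcJ4 f).
  rewrite -(linearN gcJ2) -(linearN gcJ4).
  by have /lfunP/(_ (vpair v (- f))) := gcJ_blockE; rewrite blocklE.
by rewrite blocklE !opp_lfunE; congr vpair; rewrite /= opprB addrC.
Qed.

End Blocks.

Fact twist_orth V (J : gcStruct V) x y :
  gpairing (twist_lfun J x) (twist_lfun J y) = gpairing x y.
Proof.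
case: x y => [v f] [w g].
have := gcJ_orth J (vpair v (- f)) (vpair w (- g)).
rewrite !twist_lfunE /gpairing /= !vevNl -!opprD !mulrN !opprK => <-.
by rewrite opprK.
Qed.

Fact twist_sqr V (J : gcStruct V) :
  (twist_lfun J \o twist_lfun J)%VF = - \1%VF.
Proof.
apply/lfunP => -[v f]; rewrite comp_lfunE opp_lfunE id_lfunE !twist_lfunE.
by rewrite opprK -vpair_eta gcJK !vpairN /= opprK.
Qed.

Definition twist V (J : gcStruct V) : gcStruct V :=
  GCStruct (twist_orth J) (twist_sqr J).

(* The natural identification of (V (+) W) (+) (V (+) W)^* with
   (V (+) V^* ) (+) (W (+) W^* ), and its inverse. *)
Section Identification.
Variables V W : vectType R.

Definition gsplit : 'Hom(gtan (vprod V W), vprod (gtan V) (gtan W)) :=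
  pairl (blockl (fstl V W) 0 0 (pullback (inll V W)))
        (blockl (sndl V W) 0 0 (pullback (inrl V W))).

Definition gjoin : 'Hom(vprod (gtan V) (gtan W), gtan (vprod V W)) :=
  pairl (blockl (fstl _ _) 0 0 (fstl _ _))
        ((pullback (fstl V W) \o sndl _ _ \o fstl _ _)
         + (pullback (sndl V W) \o sndl _ _ \o sndl _ _))%VF.

Lemma gsplitE v w h :
  gsplit (vpair (vpair v w) h) =
  vpair (vpair v (pullback (inll V W) h)) (vpair w (pullback (inrl V W) h)).
Proof.
by rewrite pairlE !blocklE !zero_lfunE !addr0 !add0r fstlE sndlE.
Qed.

Lemma gjoinE v f w g :
  gjoin (vpair (vpair v f) (vpair w g)) =
  vpair (vpair v w) (pullback (fstl V W) f + pullback (sndl V W) g).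
Proof.
rewrite pairlE blocklE add_lfunE !comp_lfunE !zero_lfunE addr0 add0r.
by rewrite !fstlE !sndlE.
Qed.

Lemma gsplitK : cancel gsplit gjoin.
Proof.
move=> [[v w] h]; rewrite gsplitE gjoinE; congr vpair.
apply/vdualP => -[a b]; rewrite vevDl !vev_pullback -vevDr.
by rewrite fstlE sndlE inllE inrlE vpairD addr0 add0r.
Qed.

Lemma gjoinK : cancel gjoin gsplit.
Proof.
move=> [[v f] [w g]]; rewrite gjoinE gsplitE.
congr vpair; congr vpair; apply/vdualP => a; rewrite vev_pullback vevDl;
  rewrite !vev_pullback fstlE sndlE.
  by rewrite inllE vev0r addr0.
by rewrite inrlE vev0r add0r.
Qed.

Lemma gpairing_gjoin x y x' y' :
  gpairing (gjoin (vpair x y)) (gjoin (vpair x' y')) =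
  gpairing x x' + gpairing y y'.
Proof.
case: x y x' y' => [v f] [w g] [v' f'] [w' g'].
rewrite !gjoinE /gpairing /= !vevDl !vev_pullback !fstlE !sndlE /=.
by rewrite -opprD -mulrDr addrACA.
Qed.

Definition dsum_lfun (JV : 'End(gtan V)) (JW : 'End(gtan W)) :
    'End(gtan (vprod V W)) :=
  (gjoin \o blockl JV 0 0 JW \o gsplit)%VF.

Lemma dsum_lfunE JV JW x y :
  dsum_lfun JV JW (gjoin (vpair x y)) = gjoin (vpair (JV x) (JW y)).
Proof. by rewrite !comp_lfunE gjoinK blocklE !zero_lfunE addr0 add0r. Qed.

Fact dsum_orth (JV : gcStruct V) (JW : gcStruct W) x y :
  gpairing (dsum_lfun JV JW x) (dsum_lfun JV JW y) = gpairing x y.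
Proof.
rewrite -(gsplitK x) -(gsplitK y); case: (gsplit x) (gsplit y) => [? ?] [? ?].
by rewrite !dsum_lfunE !gpairing_gjoin !gcJ_orth.
Qed.

Fact dsum_sqr (JV : gcStruct V) (JW : gcStruct W) :
  (dsum_lfun JV JW \o dsum_lfun JV JW)%VF = - \1%VF.
Proof.
apply/lfunP => x; rewrite comp_lfunE opp_lfunE id_lfunE -(gsplitK x).
by case: (gsplit x) => [? ?]; rewrite !dsum_lfunE !gcJK -vpairN linearN.
Qed.

Definition gcdsum (JV : gcStruct V) (JW : gcStruct W) : gcStruct (vprod V W) :=
  GCStruct (dsum_orth JV JW) (dsum_sqr JV JW).

End Identification.

Definition twprod V W (JV : gcStruct V) (JW : gcStruct W) :
    gcStruct (vprod V W) := gcdsum (twist JV) JW.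

Section Subspaces.
Variables (V : vectType R) (J : gcStruct V).
Implicit Type U : {vspace V}.

(* [dsumv U 0] and [dsumv 0 (annv U)] are U and Ann U inside V (+) V^*. *)
Definition gisotropic U : bool :=
  (J @: dsumv U 0 <= (dsumv U (annv U) : {vspace gtan V}))%VS.

Definition gcoisotropic U : bool :=
  (J @: dsumv 0 (annv U) <= (dsumv U (annv U) : {vspace gtan V}))%VS.

Definition glagrangian U : bool := gisotropic U && gcoisotropic U.

End Subspaces.

End GeneralizedComplex.

Section Composition.
Variables (R : realType) (V W Z : vectType R).

Definition proj13 : 'Hom(vprod (vprod V W) Z, vprod V Z) :=
  blockl (fstl V W) 0 0 \1%VF.
Definition proj23 : 'Hom(vprod (vprod V W) Z, vprod W Z) :=
  blockl (sndl V W) 0 0 \1%VF.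

Definition comp_rel (Phi : {vspace vprod W Z}) (Gamma : {vspace vprod V W}) :
    {vspace vprod V Z} :=
  (proj13 @: (fstl (vprod V W) Z @^-1: Gamma :&: proj23 @^-1: Phi))%VS.

Lemma memv_comp_rel (Phi : {vspace vprod W Z}) (Gamma : {vspace vprod V W})
    (v : V) (z : Z) :
  reflect (exists w, vpair v w \in Gamma /\ vpair w z \in Phi)
          (vpair v z \in comp_rel Phi Gamma).
Proof.
have p13 a w b : proj13 (vpair (vpair a w) b) = vpair a b.
  by rewrite blocklE !zero_lfunE id_lfunE fstlE addr0 add0r.
have p23 a w b : proj23 (vpair (vpair a w) b) = vpair w b.
  by rewrite blocklE !zero_lfunE id_lfunE sndlE addr0 add0r.
apply: (iffP memv_imgP) => [[[[a w] b]]|[w [Gvw Pwz]]].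
  rewrite memv_cap -!memv_preim fstlE p23 => /andP[Gaw Pwb].
  by rewrite p13 => -[-> ->]; exists w.
exists (vpair (vpair v w) z); last by rewrite p13.
by rewrite memv_cap -!memv_preim fstlE p23 Pwz andbT.
Qed.

End Composition.

(* Main.v *)
(** Write [conormal_rel Gamma] for the lifted relation from V (+) V^* to
    W (+) W^* that relates (v, f) to (w, g) when (v, w) lies in Gamma and f, g
    pull back to the same form on Gamma. Up to the sign change on V^*, it is
    Gamma (+) Ann Gamma, and the sign change turns the twisted product
    structure into J_V (+) J_W. Hence Gamma is isotropic (coisotropic) when
    J_V and J_W map the pairs of pure vectors (of pure covectors) in the lift
    back into the lift. Lifts compose, so pairs of vectors related by
    Phi o Gamma are dealt with by passing through an intermediate vector in W;
    for covectors the intermediate covector in W^* comes from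
    Ann(A cap B) = Ann A + Ann B, with A = Gamma x Z and B = V x Phi. *)

Require Import Defs.
From HB Require Import structures.
From mathcomp Require Import all_boot all_algebra.
From mathcomp Require Import reals.

Import GRing.Theory.
Local Open Scope ring_scope.

Definition conormal_rel {R : realType} {V W : vectType R}
    (Gamma : {vspace vprod V W}) (x : gtan V) (y : gtan W) : Prop :=
  vpair (vfst x) (vfst y) \in Gamma /\
  forall v w, vpair v w \in Gamma -> vev (vsnd x) v = vev (vsnd y) w.

Definition twjoin {R : realType} {V W : vectType R} (x : gtan V) (y : gtan W) :
    gtan (vprod V W) :=
  gjoin V W (vpair (vpair (vfst x) (- vsnd x)) y).

Section TwistedProduct.
Variables (R : realType) (V W : vectType R).
Implicit Types (x : gtan V) (y : gtan W) (Gamma : {vspace vprod V W}).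

Lemma vfst_twjoin x y : vfst (twjoin x y) = vpair (vfst x) (vfst y).
Proof. by case: x y => [v f] [w g]; rewrite /twjoin gjoinE. Qed.

Lemma vev_twjoin x y v w :
  vev (vsnd (twjoin x y)) (vpair v w) = vev (vsnd y) w - vev (vsnd x) v.
Proof.
case: x y => [a f] [b g]; rewrite /twjoin gjoinE /= vevDl !vev_pullback.
by rewrite fstlE sndlE vevNl addrC.
Qed.

Lemma twjoin_surj (t : gtan (vprod V W)) : exists x y, t = twjoin x y.
Proof.
rewrite -(gsplitK t); case: (gsplit V W t) => [[v f] y].
by exists (vpair v (- f)), y; rewrite /twjoin /= opprK.
Qed.

(** The twist conjugates [JV] by the sign change on covectors; [twjoin] already carries that sign,
    so the two cancel. *)
Lemma twprod_twjoin (JV : gcStruct V) (JW : gcStruct W) x y :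
  twprod JV JW (twjoin x y) = twjoin (JV x) (JW y).
Proof.
case: x => v f.
by rewrite /= /twjoin dsum_lfunE [twist JV _]twist_lfunE /= opprK.
Qed.

Lemma annv_twjoinP Gamma x y :
  vsnd (twjoin x y) \in annv Gamma <->
  forall v w, vpair v w \in Gamma -> vev (vsnd x) v = vev (vsnd y) w.
Proof.
split=> [/memv_annv ann v w Gvw | eqxy].
  by have /eqP := ann _ Gvw; rewrite vev_twjoin subr_eq0 => /eqP.
by apply/memv_annv => -[v w] Gvw; rewrite vev_twjoin (eqxy v w Gvw) subrr.
Qed.

Lemma memv_twjoinP Gamma x y :
  (twjoin x y \in (dsumv Gamma (annv Gamma) : {vspace gtan _})) <->
  conormal_rel Gamma x y.
Proof.
rewrite [twjoin x y]vpair_eta memv_dsumv vfst_twjoin /conormal_rel.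
split; first by case/andP=> -> /annv_twjoinP.
by case=> -> /annv_twjoinP.
Qed.

Lemma twjoin_vectors (v : V) (w : W) :
  twjoin (vpair v 0) (vpair w 0) = vpair (vpair v w) 0.
Proof. by rewrite /twjoin gjoinE /= oppr0 !linear0 addr0. Qed.

Lemma twjoin_covectors (f : vdual V) (g : vdual W) :
  twjoin (vpair 0 f) (vpair 0 g) =
  vpair 0 (vsnd (twjoin (vpair 0 f) (vpair 0 g))).
Proof. by rewrite [LHS]vpair_eta vfst_twjoin. Qed.

Lemma gisotropic_twprodP (JV : gcStruct V) (JW : gcStruct W) Gamma :
  gisotropic (twprod JV JW) Gamma <->
  forall v w, vpair v w \in Gamma ->
    conormal_rel Gamma (JV (vpair v 0)) (JW (vpair w 0)).
Proof.
split=> [iso v w Gvw | iso].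
  apply/memv_twjoinP; rewrite -twprod_twjoin.
  apply: (subvP iso); apply: memv_img.
  by rewrite twjoin_vectors memv_dsumv Gvw mem0v.
apply/subvP => _ /memv_imgP[[[v w] h] + ->].
rewrite memv_dsumv memv0 => /andP[Gvw /eqP->].
rewrite -[(_, 0)]twjoin_vectors twprod_twjoin.
by apply/memv_twjoinP/iso.
Qed.

Lemma gcoisotropic_twprodP (JV : gcStruct V) (JW : gcStruct W) Gamma :
  gcoisotropic (twprod JV JW) Gamma <->
  forall f g,
    (forall v w, vpair v w \in Gamma -> vev f v = vev g w) ->
    conormal_rel Gamma (JV (vpair 0 f)) (JW (vpair 0 g)).
Proof.
split=> [coiso f g eqfg | coiso].
  apply/memv_twjoinP; rewrite -twprod_twjoin.
  apply: (subvP coiso); apply: memv_img.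
  rewrite twjoin_covectors memv_dsumv mem0v.
  exact/annv_twjoinP.
apply/subvP => _ /memv_imgP[t + ->].
(* Every form on the product is a difference of a form [g] on [W] and a form [f] on [V], so pairs
   [f], [g] exhaust the annihilator of [Gamma]. *)
have [[v f] [[w g] ->]] := twjoin_surj t.
rewrite [X in X \in _]vpair_eta memv_dsumv memv0 vfst_twjoin.
move=> /andP[/eqP[/= -> ->] /annv_twjoinP eqfg]; rewrite twprod_twjoin.
by apply/memv_twjoinP/coiso.
Qed.

End TwistedProduct.

(** This gives the inclusion of Ann(A cap B) in Ann A + Ann B: [F] is the sum of [G] and [F - G],
    which vanishes on [B]. *)
Lemma ann_cap_split {R : realType} {X : vectType R} (A B : {vspace X})
    (F : vdual X) :
  (forall u, u \in (A :&: B)%VS -> vev F u = 0) ->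
  exists2 G : vdual X, forall a, a \in A -> vev G a = 0 &
    forall b, b \in B -> vev G b = vev F b.
Proof.
(* The projection [addv_pi2 A B] fixes [B] pointwise. It maps [A] into the intersection, where [F]
   vanishes: for [a] in [A], the other component of [a] lies in [A], hence so does the
   difference. *)
move=> F0; exists (precomp (addv_pi2 A B) F) => [a Aa | b Bb];
  rewrite /precomp /vev comp_lfunE.
  apply: F0; rewrite memv_cap memv_pi2 andbT.
  have AB_a : a \in (A + B)%VS by apply: subvP Aa; exact: addvSl.
  rewrite -(addKr (addv_pi1 A B a) (addv_pi2 A B a)) addv_pi1_pi2 // addrC.
  by rewrite memvB // memv_pi1.
by rewrite addv_pi2_id.
Qed.

Section Composition.
Variables (R : realType) (V W Z : vectType R).
Variables (Gamma : {vspace vprod V W}) (Phi : {vspace vprod W Z}).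

(** The vector part composes through [vfst y]; the forms are compared through the covector of [y],
    evaluated at whichever middle vector links the two ends. *)
Lemma conormal_rel_comp (x : gtan V) (y : gtan W) (z : gtan Z) :
  conormal_rel Gamma x y -> conormal_rel Phi y z ->
  conormal_rel (comp_rel Phi Gamma) x z.
Proof.
move=> [Gxy eqxy] [Pyz eqyz]; split; first by apply/memv_comp_rel; exists (vfst y).
by move=> v c /memv_comp_rel[w [/eqxy-> /eqyz]].
Qed.

Lemma comp_rel_covector (f : vdual V) (h : vdual Z) :
  (forall v z, vpair v z \in comp_rel Phi Gamma -> vev f v = vev h z) ->
  exists g : vdual W,
    (forall v w, vpair v w \in Gamma -> vev f v = vev g w) /\
    (forall w z, vpair w z \in Phi -> vev g w = vev h z).
Proof.
move=> eqfh.
pose A := (fstl (vprod V W) Z @^-1: Gamma)%VS.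
pose B := (proj23 V W Z @^-1: Phi)%VS.
have memA v w z : (vpair (vpair v w) z \in A) = (vpair v w \in Gamma).
  by rewrite -memv_preim fstlE.
have memB v w z : (vpair (vpair v w) z \in B) = (vpair w z \in Phi).
  by rewrite -memv_preim blocklE !zero_lfunE id_lfunE sndlE addr0 add0r.
pose F : vdual (vprod (vprod V W) Z) :=
  pullback (fstl _ _) (pullback (fstl V W) f) - pullback (sndl _ _) h.
have evF v w z : vev F (vpair (vpair v w) z) = vev f v - vev h z.
  by rewrite vevDl vevNl !vev_pullback !fstlE sndlE.
have [|G GA GB] := ann_cap_split A B F.
  move=> [[v w] z]; rewrite memv_cap memA memB => /andP[Gvw Pwz].
  by rewrite evF (eqfh v z) ?subrr //; apply/memv_comp_rel; exists w.
(* [A] contains the summand [Z], so [G] ignores [z]; [B] contains the summand [V], so [G] agrees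
   with [f] there. Thus [G] sends (v, w, z) to f(v) - g(w), which fixes the sign of [g]. Vanishing
   on [A] gives the claim for [Gamma], and agreement with [F] on [B] the one for [Phi]. *)
pose g : vdual W := - pullback (inrl V W) (pullback (inll _ Z) G).
have evg w : vev g w = - vev G (vpair (vpair 0 w) 0).
  by rewrite vevNl !vev_pullback inrlE inllE.
exists g; split=> [v w Gvw | w z Pwz]; rewrite evg.
  have := GA (vpair (vpair v w) 0); rewrite memA => /(_ Gvw).
  have -> : vpair (vpair v w) 0
      = vpair (vpair v 0) 0 + vpair (vpair 0 w) 0 :> vprod (vprod V W) Z.
    by rewrite !vpairD !addr0 add0r.
  rewrite vevDr GB ?memB ?mem0v // evF vev0r subr0 => /eqP.
  by rewrite addr_eq0 => /eqP.
have := GB (vpair (vpair 0 w) z); rewrite memB evF vev0r sub0r => /(_ Pwz).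
have -> : vpair (vpair 0 w) z
    = vpair (vpair 0 w) 0 + vpair (vpair 0 0) z :> vprod (vprod V W) Z.
  by rewrite !vpairD !addr0 add0r.
by rewrite vevDr [X in _ + X]GA ?memA ?mem0v // addr0 => ->; rewrite opprK.
Qed.

End Composition.

Theorem theorem6p2 (R : realType) (V W Z : vectType R)
    (JV : gcStruct V) (JW : gcStruct W) (JZ : gcStruct Z)
    (Gamma : {vspace vprod V W}) (Phi : {vspace vprod W Z}) :
  [/\ gisotropic (twprod JV JW) Gamma -> gisotropic (twprod JW JZ) Phi ->
        gisotropic (twprod JV JZ) (comp_rel Phi Gamma),
      gcoisotropic (twprod JV JW) Gamma -> gcoisotropic (twprod JW JZ) Phi ->
        gcoisotropic (twprod JV JZ) (comp_rel Phi Gamma)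
    & glagrangian (twprod JV JW) Gamma -> glagrangian (twprod JW JZ) Phi ->
        glagrangian (twprod JV JZ) (comp_rel Phi Gamma)].
Proof.
have isotropic_comp : gisotropic (twprod JV JW) Gamma ->
    gisotropic (twprod JW JZ) Phi ->
    gisotropic (twprod JV JZ) (comp_rel Phi Gamma).
  move=> /gisotropic_twprodP isoG /gisotropic_twprodP isoP.
  apply/gisotropic_twprodP => v z /memv_comp_rel[w [Gvw Pwz]].
  exact: conormal_rel_comp (isoG _ _ Gvw) (isoP _ _ Pwz).
have coisotropic_comp : gcoisotropic (twprod JV JW) Gamma ->
    gcoisotropic (twprod JW JZ) Phi ->
    gcoisotropic (twprod JV JZ) (comp_rel Phi Gamma).
  move=> /gcoisotropic_twprodP coisoG /gcoisotropic_twprodP coisoP.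
  apply/gcoisotropic_twprodP => f h /comp_rel_covector[g [eqfg eqgh]].
  exact: conormal_rel_comp (coisoG _ _ eqfg) (coisoP _ _ eqgh).
split=> // /andP[isoG coisoG] /andP[isoP coisoP].
by rewrite /glagrangian isotropic_comp ?coisotropic_comp.
Qed.
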